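(* For all real $\sigma_W>0$, $P_X>0$, $P_Q>0$, $$\lim_{\bar\sigma_S\to0^+}\varrho\left(\sigma_W^2,P_X^2,\Gamma(\sigma_W,\bar\sigma_S,P_X,P_Q)\right)=\frac12\log_2\left(1+\frac{P_X^2}{\sigma_W^2}\right),$$ where $\Gamma(\sigma_W,\bar\sigma_S,P_X,P_Q)=(P_X+\sigma_W)\frac{\bar\sigma_S}{P_Q-\bar\sigma_S}$ for $0<\bar\sigma_S<P_Q$.
   Context: For $\sigma_W,P_X,\bar\sigma_V>0$ with $4\bar\sigma_V^2\le P_X^2$, $\varrho(\sigma_W^2,P_X^2,\bar\sigma_V)$ is the unique non-negative real solution $\varrho$ of $\sigma_W\sqrt{2^{2\varrho}-1}=P_X-\bar\sigma_V(1+2^{\varrho})$; if $4\bar\sigma_V^2>P_X^2$, it is defined to be $0$. *)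

(* Defs.v *)
From mathcomp Require Import all_boot all_order all_algebra.
From mathcomp Require Import all_classical all_reals all_analysis.
From mathcomp Require Import ring lra.
Import Order.TTheory GRing.Theory Num.Theory.
Import numFieldNormedType.Exports.

Set Implicit Arguments.
Unset Strict Implicit.
Unset Printing Implicit Defensive.

Local Open Scope classical_set_scope.
Local Open Scope ring_scope.

Definition log2 (R : realType) (x : R) : R := ln x / ln 2.

Definition varrho_sol (R : realType) (sigmaW PX sigmaV : R) : set R :=
  [set r | 0 <= r /\
    sigmaW * Num.sqrt (2 `^ (2 * r) - 1) = PX - sigmaV * (1 + 2 `^ r)].

(* As in varrho(sigma_W^2, P_X^2, sigma_V), the first two arguments are the
   squares sigma_W^2 and P_X^2. For positive sigma_W, P_X, sigma_V, the default
   0 of [xget] is never used: see [varrho_sol_unique]. *)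
Definition varrho (R : realType) (sigmaW2 PX2 sigmaV : R) : R :=
  if 4 * sigmaV ^+ 2 <= PX2
  then xget 0 (varrho_sol (Num.sqrt sigmaW2) (Num.sqrt PX2) sigmaV)
  else 0.

Definition Gamma (R : realType) (sigmaW sigmaS PX PQ : R) : R :=
  (PX + sigmaW) * (sigmaS / (PQ - sigmaS)).

Lemma varrho_sol_unique (R : realType) (sigmaW PX sigmaV : R) :
  0 < sigmaW -> 0 < PX -> 0 < sigmaV -> 4 * sigmaV ^+ 2 <= PX ^+ 2 ->
  exists! r, varrho_sol sigmaW PX sigmaV r.
Proof.
move=> w0 p0 v0 hle.
have vp : 2 * sigmaV <= PX by nra.
pose f (r : R) := sigmaW * Num.sqrt (2 `^ (2 * r) - 1) + sigmaV * (1 + 2 `^ r).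
have solE r : varrho_sol sigmaW PX sigmaV r <-> 0 <= r /\ f r = PX.
  by rewrite /varrho_sol /f /=; split=> -[r0 h]; split=> //; lra.
have pow_lt (r s : R) : r < s -> 2 `^ r < 2 `^ s :> R.
  by move=> rs; rewrite /powR pnatr_eq0 /= ltr_expR ltr_pM2r// ln_gt0// ltr1n.
have f_lt (r s : R) : r < s -> f r < f s.
  move=> rs; apply: ler_ltD.
    apply: ler_wpM2l; first exact: ltW.
    apply: ler_wsqrtr; rewrite lerD2r ltW//; apply: pow_lt; lra.
  by rewrite ltr_pM2l// ltrD2l; exact: pow_lt.
have pow_cts : continuous (fun r : R => 2 `^ r : R).
  move=> r; rewrite /powR pnatr_eq0 /=.
  apply: continuous_comp; last exact: continuous_expR.
  by apply: cvgM; [exact: cvg_id | exact: cvg_cst].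
have f_cts : continuous f.
  move=> r; apply: cvgD.
    apply: cvgM; first exact: cvg_cst.
    apply: (@continuous_comp _ _ _ (fun r : R => 2 `^ (2 * r) - 1 : R)); last exact: sqrt_continuous.
    apply: cvgB; last exact: cvg_cst.
    apply: (@continuous_comp _ _ _ (fun r : R => 2 * r)); last exact: pow_cts.
    by apply: cvgM; [exact: cvg_cst | exact: cvg_id].
  apply: cvgM; first exact: cvg_cst.
  by apply: cvgD; [exact: cvg_cst | exact: pow_cts].
have ln2 : 0 < ln 2 :> R by rewrite ln_gt0// ltr1n.
pose b : R := ln (1 + PX / sigmaV) / ln 2.
have q0 : 0 < PX / sigmaV by rewrite divr_gt0.
have b0 : 0 <= b by rewrite divr_ge0 ?ln_ge0 ?(ltW ln2)//; lra.
have powb : 2 `^ b = 1 + PX / sigmaV.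
  by rewrite /powR pnatr_eq0 /= /b divfK ?gt_eqF// lnK// posrE; lra.
have fa : f 0 <= PX by rewrite /f mulr0 powRr0 subrr sqrtr0 mulr0; lra.
have fb : PX <= f b.
  have : 0 <= sigmaW * Num.sqrt (2 `^ (2 * b) - 1).
    by rewrite mulr_ge0 ?sqrtr_ge0 ?ltW.
  have : sigmaV * (PX / sigmaV) = PX by rewrite mulrC divfK ?gt_eqF.
  by rewrite /f powb !mulrDr; lra.
have [|r rI fr] := @IVT _ f 0 b PX b0 (continuous_subspaceT f_cts).
  by rewrite ge_min fa le_max fb orbT.
exists r; split.
  by apply/solE; split=> //; move: rI; rewrite in_itv /= => /andP[].
move=> s /solE[_ fs]; case: (ltgtP r s) => // /f_lt; rewrite fr fs ltxx//.
Qed.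

(* Main.v *)
Require Import Defs.
From mathcomp Require Import all_boot all_order all_algebra.
From mathcomp Require Import all_classical all_reals all_analysis.
From mathcomp Require Import ring lra.
Import Order.TTheory GRing.Theory Num.Theory.
Import numFieldNormedType.Exports.
Local Open Scope classical_set_scope.
Local Open Scope ring_scope.

(** Write [g r = sigmaW * sqrt (2^(2r) - 1)], whose inverse is
    [y |-> 1/2 log2 (1 + y^2 / sigmaW^2)]. The solution [r] of
    [g r = PX - v (1 + 2^r)] satisfies [g r <= PX], so [2^r] stays below
    [1 + PX^2 / sigmaW^2] as [v] varies. Hence [g r] tends to [PX] as [v]
    tends to [0], and the continuous inverse of [g] carries this over to [r].
    It remains to see that [Gamma] tends to [0] from the right. *)

Definition capacity {R : realType} (sigmaW y : R) : R :=
  1 / 2 * log2 (1 + y ^+ 2 / sigmaW ^+ 2).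

Lemma capacity_continuous {R : realType} (sigmaW : R) :
  continuous (capacity sigmaW).
Proof.
move=> y; rewrite /capacity /log2.
apply: cvgM; first exact: cvg_cst.
apply: cvgM; last exact: cvg_cst.
apply: (@continuous_comp _ _ _ (fun y : R => 1 + y ^+ 2 / sigmaW ^+ 2)).
  apply: cvgD; first exact: cvg_cst.
  by apply: cvgM; [exact: exprn_continuous | exact: cvg_cst].
(* The argument of [ln] is at least 1, so it stays away from the singularity at 0. *)
by apply: continuous_ln; rewrite ltr_wpDr// divr_ge0 ?sqr_ge0.
Qed.

Lemma powR_double {R : realType} (r : R) : 2 `^ (2 * r) = (2 `^ r) ^+ 2 :> R.
Proof. by rewrite mulrC powRrM powR_mulrn// powR_ge0. Qed.

Lemma powR2_ge1 {R : realType} {r : R} : 0 <= r -> 1 <= 2 `^ r :> R.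
Proof. by move=> r0; rewrite -[leLHS](powRr0 2) ler_powR// ler1n. Qed.

(** For [0 <= r] the radicand is non-negative, so [Num.sqrt] does not fall back to its default value
    0. *)
Lemma sqr_sqrt_powR {R : realType} {sigmaW r : R} : 0 <= r ->
  (sigmaW * Num.sqrt (2 `^ (2 * r) - 1)) ^+ 2
    = sigmaW ^+ 2 * ((2 `^ r) ^+ 2 - 1).
Proof.
move=> r0; rewrite exprMn sqr_sqrtr powR_double//.
by have := powR2_ge1 r0; nra.
Qed.

Lemma capacityK {R : realType} {sigmaW r : R} : 0 < sigmaW -> 0 <= r ->
  capacity sigmaW (sigmaW * Num.sqrt (2 `^ (2 * r) - 1)) = r.
Proof.
move=> w0 r0; have ln2 : 0 < ln 2 :> R by rewrite ln_gt0// ltr1n.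
rewrite /capacity sqr_sqrt_powR// [X in 1 + X]mulrAC divff ?mul1r; last first.
  by rewrite expf_neq0// gt_eqF.
by rewrite addrCA subrr addr0 -powR_double /log2 ln_powR; field; rewrite gt_eqF.
Qed.

(** The bound [2 * v <= PX] selects the first branch of [varrho], and existence of a solution keeps
    [xget] off its default. *)
Lemma varrho_solP {R : realType} {sigmaW PX v : R} :
  0 < sigmaW -> 0 < PX -> 0 < v -> 2 * v <= PX ->
  varrho_sol sigmaW PX v (varrho (sigmaW ^+ 2) (PX ^+ 2) v).
Proof.
move=> w0 p0 v0 vp; have hle : 4 * v ^+ 2 <= PX ^+ 2 by nra.
rewrite /varrho hle !sqrtr_sqr !gtr0_norm//.
have [r [rP _]] := varrho_sol_unique w0 p0 v0 hle.
exact: xgetPex (ex_intro _ r rP).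
Qed.

Lemma varrho_sol_powR_le {R : realType} {sigmaW PX v r : R} :
  0 < sigmaW -> 0 < v -> varrho_sol sigmaW PX v r ->
  2 `^ r <= 1 + PX ^+ 2 / sigmaW ^+ 2.
Proof.
move=> w0 v0 [r0 rE].
have x1 := powR2_ge1 r0.
have gr0 : 0 <= sigmaW * Num.sqrt (2 `^ (2 * r) - 1).
  by rewrite mulr_ge0 ?sqrtr_ge0 ?ltW.
have grp : sigmaW * Num.sqrt (2 `^ (2 * r) - 1) <= PX by rewrite rE; nra.
have gr2 : sigmaW ^+ 2 * ((2 `^ r) ^+ 2 - 1) <= PX ^+ 2.
  by rewrite -sqr_sqrt_powR// ler_sqr// nnegrE// (le_trans gr0).
(* Since [2 ^ r] is at least 1, it is at most its square; this cruder bound avoids a square root. *)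
apply: (@le_trans _ _ ((2 `^ r) ^+ 2)); first by nra.
by rewrite -lerBlDl ler_pdivlMr ?exprn_gt0// mulrC.
Qed.

Lemma varrho_cvg {R : realType} {sigmaW PX : R} : 0 < sigmaW -> 0 < PX ->
  varrho (sigmaW ^+ 2) (PX ^+ 2) v @[v --> 0^'+] --> capacity sigmaW PX.
Proof.
move=> w0 p0; set K := 1 + PX ^+ 2 / sigmaW ^+ 2.
pose rho v := varrho (sigmaW ^+ 2) (PX ^+ 2) v.
(* This is the right-hand side of the defining equation, hence [g (rho v)] whenever [rho v] is a
   solution. *)
pose y v : R := PX - v * (1 + 2 `^ rho v).
have vp : \forall v \near (0 : R)^'+, 0 < v /\ 2 * v <= PX.
  near=> v; split; first by near: v; exact: nbhs_right_gt.
  suff : v <= PX / 2 by lra.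
  by near: v; apply: nbhs_right_le; rewrite divr_gt0.
have ycvg : y v @[v --> 0^'+] --> PX.
  (* The two bounds come from [0 <= 2 ^ rho v <= K], where [K] does not depend on [v]. *)
  apply: (@squeeze_cvgr _ _ _ _ (fun v => PX - v * (1 + K)) (fun=> PX)).
  - near=> v; have [v0 v2p] : 0 < v /\ 2 * v <= PX by near: v.
    have := varrho_sol_powR_le w0 v0 (varrho_solP w0 p0 v0 v2p).
    have : 0 <= 2 `^ rho v by exact: powR_ge0.
    by rewrite /y -/K -/(rho v) => ? ?; apply/andP; split; nra.
  - rewrite -[X in _ --> X]subr0 -[X in _ - X](mul0r (1 + K)).
    apply: cvg_at_right_filter; apply: cvgB; first exact: cvg_cst.
    by apply: cvgM; [exact: cvg_id | exact: cvg_cst].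
  - exact: cvg_cst.
apply: cvg_trans (cvg_comp _ _ ycvg (capacity_continuous sigmaW PX)).
apply: near_eq_cvg; near=> v.
have [v0 v2p] : 0 < v /\ 2 * v <= PX by near: v.
have [r0 rE] := varrho_solP w0 p0 v0 v2p.
by rewrite /= /y -rE capacityK.
Unshelve. all: by end_near. Qed.

(** The limit is taken in [0^'+] because [varrho_cvg] only concerns positive [v]; positivity holds
    once [s < PQ]. *)
Lemma Gamma_cvg {R : realType} {sigmaW PX PQ : R} :
  0 < sigmaW -> 0 < PX -> 0 < PQ ->
  Gamma sigmaW s PX PQ @[s --> 0^'+] --> 0^'+.
Proof.
move=> w0 p0 q0 A rA.
have Gamma0 : Gamma sigmaW s PX PQ @[s --> 0^'+] --> 0.
  have E : (PX + sigmaW) * (0 / (PQ - 0)) = 0 by rewrite mul0r mulr0.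
  rewrite -[X in _ --> X]E.
  apply: cvg_at_right_filter; apply: cvgM; first exact: cvg_cst.
  apply: cvgM; first exact: cvg_id.
  apply: cvgV; first by rewrite subr0 gt_eqF.
  by apply: cvgB; [exact: cvg_cst | exact: cvg_id].
have Gamma_gt0 : \forall s \near 0^'+, 0 < Gamma sigmaW s PX PQ.
  near=> s; rewrite /Gamma mulr_gt0 ?addr_gt0// divr_gt0// ?subr_gt0.
  by near: s; exact: nbhs_right_lt.
(* By [rA], all positive points near 0 lie in [A]. *)
by apply: filterS2 (Gamma0 _ rA) Gamma_gt0 => s; exact.
Unshelve. all: by end_near. Qed.

Theorem mainTheorem5 (R : realType) (sigmaW PX PQ : R)
    (hW : 0 < sigmaW) (hX : 0 < PX) (hQ : 0 < PQ) :
  varrho (sigmaW ^+ 2) (PX ^+ 2) (Gamma sigmaW sigmaS PX PQ) @[sigmaS --> 0^'+]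
    --> 1 / 2 * log2 (1 + PX ^+ 2 / sigmaW ^+ 2).
Proof.
exact: cvg_comp (Gamma_cvg hW hX hQ) (varrho_cvg hW hX).
Qed.
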